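(* Let $\mathcal{A}$ be a finite alphabet, $\mathcal{F}\subset\mathcal{A}^*$ a set of forbidden words, $X=X(\mathcal{A},\mathcal{F})$ the induced subshift, and let $G\subset\mathcal{L}(X)$ be the set of all words in $\mathcal{L}(X)$ which have no heavy subword as a prefix and no heavy subword as a suffix. If there exists $\alpha < h(X)$ so that \[ \sum_{n = 1}^{\infty} n^2 |\mathcal{F}_n| e^{-(n/3)\alpha} < 1 - e^{-\alpha}, \] then for every ergodic measure of maximal entropy $\mu$ on $X$, there exist $\epsilon > 0$ and a syndetic set $S\subseteq\mathbb{N}$ so that $\mu(G_n) > \epsilon$ for all $n \in S$.
   Context: $\mathcal{A}^*$ is the set of finite (nonempty) words over $\mathcal{A}$, and $\mathcal{F}_n$ is the set of words in $\mathcal{F}$ of length $n$ ($\mathcal{F}$ may be infinite). $X(\mathcal{A},\mathcal{F})$ is the set of all $x\in\mathcal{A}^{\mathbb{Z}}$ that contain no word from $\mathcal{F}$ as a (contiguous) subword; it is assumed nonempty. $\sigma$ is the shift $(\sigma x)_n=x_{n+1}$. $\mathcal{L}(X)$ is the set of all finite words appearing in points of $X$, $\mathcal{L}_n(X)$ those of length $n$, and $h(X)=\lim_{n\to\infty}\frac1n\log|\mathcal{L}_n(X)|$ (natural logarithm). Subwords, prefixes and suffixes of a word are allowed to equal the whole word. A heavy subword is a (contiguous) subword of some $u\in\mathcal{F}$ whose length is at least $|u|/3$. $G_n$ is the set of words in $G$ of length $n$; $[w]=\{x\in X: x_1\ldots x_n=w\}$ for a word $w$ of length $n$; $\mu(G_n):=\mu\left(\bigcup_{w\in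 G_n}[w]\right)$. A measure of maximal entropy (MME) on $X$ is a $\sigma$-invariant Borel probability measure $\mu$ supported on $X$ with measure-theoretic entropy $h(\mu)=\lim_n -\frac1n\sum_{w\in\mathcal{A}^n}\mu([w])\log\mu([w])$ equal to $h(X)$. A set $S\subseteq\mathbb{N}$ is syndetic if there exists $N$ so that $\{k,\ldots,k+N-1\}\cap S\neq\varnothing$ for every $k$. *)

(* Defs.v *)
From HB Require Import structures.
From mathcomp Require Import all_boot all_order all_algebra.
From mathcomp Require Import all_classical all_reals all_analysis.

Set Implicit Arguments.
Unset Strict Implicit.
Unset Printing Implicit Defensive.

Import Order.TTheory GRing.Theory Num.Theory.
Import numFieldNormedType.Exports.

Local Open Scope classical_set_scope.
Local Open Scope ring_scope.

(** [measurableType]s are pointed, so an alphabet is a finite type with a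
    distinguished letter. The letter plays no role beyond making the alphabet
    nonempty, which any alphabet with a nonempty subshift is. *)
#[short(type="alphabetType")]
HB.structure Definition Alphabet := {A of Finite A & Pointed A}.

Definition full_shift (A : alphabetType) : Type :=
  prod_topology (fun _ : int => discrete_topology A).

HB.instance Definition _ (A : alphabetType) := Pointed.on (full_shift A).
HB.instance Definition _ (A : alphabetType) := Topological.on (full_shift A).

(** The full shift with its Borel sigma-algebra. *)
Definition borel_full_shift (A : alphabetType) : Type :=
  g_sigma_algebraType (@open (full_shift A)).

HB.instance Definition _ (A : alphabetType) :=
  Measurable.on (borel_full_shift A).

Section Words.
Variable A : alphabetType.
Implicit Types (x : borel_full_shift A) (X : set (borel_full_shift A)).
Implicit Types (w u v : seq A) (F W : set (seq A)).

Definition shift_map (x : borel_full_shift A) : borel_full_shift A :=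
  fun i => x (i + 1).

(** The word x_i x_(i+1) ... x_(i+n-1). *)
Definition block x (i : int) (n : nat) : seq A :=
  mkseq (fun k => x (i + k%:Z)) n.

Definition nonempty_words : set (seq A) := [set w | w != [::]].

Definition words_of_length W (n : nat) : set (seq A) :=
  [set w | W w /\ size w = n].

Definition num_words W (n : nat) : nat :=
  #|[pred t : n.-tuple A | (t : seq A) \in W]|.

Definition subshift F : set (borel_full_shift A) :=
  [set x | forall u i, F u -> block x i (size u) <> u].

Definition language X : set (seq A) :=
  [set w | nonempty_words w /\
           exists x i, X x /\ block x i (size w) = w].

Definition cylinder X w : set (borel_full_shift A) :=
  [set x | X x /\ block x 1 (size w) = w].

Definition cylinder_union X W (n : nat) : set (borel_full_shift A) :=
  \bigcup_(w in words_of_length W n) cylinder X w.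

Definition heavy F : set (seq A) :=
  [set v | exists u, [/\ F u, infix v u & (size u <= 3 * size v)%N]].

Definition good_words F : set (seq A) :=
  [set w | [/\ language (subshift F) w,
               ~ (exists2 v, heavy F v & prefix v w) &
               ~ (exists2 v, heavy F v & suffix v w)]].

End Words.

Section Entropy.
Variables (R : realType) (A : alphabetType).
Implicit Types (X : set (borel_full_shift A)).
Implicit Types (mu : probability (borel_full_shift A) R).

(** The terms of index 0 of the two sequences below are irrelevant. *)
Definition topological_entropy X : R :=
  limn (fun n : nat => n%:R^-1 * ln (num_words (language X) n)%:R).

(** [ln 0 = 0], so that null cylinders contribute 0. *)
Definition measure_entropy X mu : R :=
  limn (fun n : nat =>
    - n%:R^-1 * \sum_(w : n.-tuple A)
      fine (mu (cylinder X w)) * ln (fine (mu (cylinder X w)))).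

Definition shift_invariant mu : Prop :=
  forall B, measurable B -> mu (@shift_map A @^-1` B) = mu B.

Definition ergodic mu : Prop :=
  shift_invariant mu /\
  forall B, measurable B -> @shift_map A @^-1` B = B ->
    mu B = 0%E \/ mu B = 1%E.

Definition measure_of_maximal_entropy X mu : Prop :=
  [/\ shift_invariant mu, mu X = 1%E &
      measure_entropy X mu = topological_entropy X].

End Entropy.

Definition syndetic (S : set nat) : Prop :=
  exists N : nat, forall k : nat, exists2 n, S n & (k <= n < k + N)%N.

(* Main.v *)
Require Import Defs.
From HB Require Import structures.
From mathcomp Require Import all_boot all_order all_algebra.
From mathcomp Require Import all_classical all_reals all_analysis lra zify.

Import Order.TTheory GRing.Theory Num.Theory.
Import numFieldNormedType.Exports.

Local Open Scope classical_set_scope.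
Local Open Scope ring_scope.

(** Call a position of a point of the subshift X a start gap if no heavy word
    begins there, and an end gap if no heavy word ends just before it. If
    position 1 of x is a start gap and position n + 1 is an end gap, then
    x_1 ... x_n is good. So it is enough that gaps of both kinds have positive
    measure, and that they meet with bounded waiting time.

    Gaps have positive measure because of entropy. Summability of
    [n^2 |F_n| e^(-(n/3) alpha)] gives a Kraft inequality for the heavy words: a
    word of F of length n has at most n^2 heavy subwords counted with position,
    each of length at least n/3 ([heavy_kraft_bound]). The slack e^(-alpha) pays
    for the single letters, so heavy words of weight e^(-alpha |v|) and letters of
    weight e^(-alpha)/|A| have total weight at most 1. Writing a word as a
    concatenation of such tokens in all possible ways and adding the weights
    gives a subprobability on A^n ([sum_parse_weight_le1]). A greedy parse uses a
    letter only at a gap, so this weight is at least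
    e^(-alpha n) |A|^(-number of gaps) ([parse_weight_ge]). Gibbs' inequality
    against it yields
      H_n(mu) <= alpha n + ln |A| * E_mu(number of gaps among n positions),
    hence h(mu) <= alpha + ln |A| * mu(gap) in the limit. As
    h(mu) = h(X) > alpha, gaps have positive measure ([measure_no_start_gt0];
    [measure_no_end_gt0] by reversing words).

    Gaps meet because of ergodicity. For mu P, mu Q > 0, almost every orbit
    visits Q, so some finite union of N preimages of Q has measure above
    1 - mu(P)/2, and so do its preimages under all shift^k. P therefore meets it
    in measure at least mu(P)/2, and one of the N times in the window k, ...,
    k + N - 1 takes a definite share ([ergodic_syndetic_return]). *)

Set Implicit Arguments.
Unset Strict Implicit.
Unset Printing Implicit Defensive.

(** * Weighting the parses of a word *)

Section Parsing.
Variables (R : realType) (A : finType) (H : set (seq A)).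
Implicit Types (w v : seq A) (a : R).

Definition starts_in w : bool := `[< exists2 v, H v & prefix v w >].

Fixpoint num_gaps w : nat :=
  if w is _ :: w' then (~~ starts_in w + num_gaps w')%N else 0%N.

(** In the weights, [a] stands for e^(-alpha). A single letter gets the
    additional weight [a / #|A|], so that all letters together contribute
    exactly [a]. *)
Definition token_weight a v : R :=
  a ^+ size v * ((v \in H)%:R + (size v == 1)%:R / #|A|%:R).

(** The total weight of the ways to cut [w] into at most [m] tokens; k + 1 is
    the length of the first token. *)
Fixpoint parse_weight a m w : R :=
  (w == [::])%:R + (if m is m'.+1 then \sum_(k < size w)
    token_weight a (take k.+1 w) * parse_weight a m' (drop k.+1 w) else 0).

Lemma num_gapsE w :
  num_gaps w = (\sum_(i < size w) ~~ starts_in (drop i w))%N.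
Proof. by elim: w => [|x w IH] /=; rewrite ?big_ord0// big_ord_recl /= IH. Qed.

Lemma num_gaps_drop k w : (num_gaps (drop k w) <= num_gaps w)%N.
Proof.
elim: w k => [|x w IH] [|k] //=.
exact: leq_trans (IH k) (leq_addl _ _).
Qed.

Lemma token_weight_ge0 a v : 0 <= a -> 0 <= token_weight a v.
Proof. by move=> a0; rewrite mulr_ge0 ?exprn_ge0 ?addr_ge0 ?divr_ge0. Qed.

Lemma parse_weight_ge0 a m w : 0 <= a -> 0 <= parse_weight a m w.
Proof.
move=> a0; elim: m w => [|m IH] w /=; rewrite addr_ge0 // sumr_ge0 // => k _.
by rewrite mulr_ge0 ?token_weight_ge0.
Qed.

(** The greedy parse takes a word of [H] whenever one starts at the current
    position and a single letter otherwise. A factor 1/|A| is lost only in the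
    second case, at a gap, and jumping over a word of [H] can only skip gaps. *)
Lemma parse_weight_ge a m w : 0 <= a -> (forall v, H v -> v != [::]) ->
  (size w <= m)%N ->
  a ^+ size w / #|A|%:R ^+ num_gaps w <= parse_weight a m w.
Proof.
move=> a0 Hn0; elim: m w => [|m IH] w.
  by rewrite leqn0 size_eq0 => /eqP -> /=; rewrite !expr0 divr1 addr0.
case: w => [_|x w wm]; first by rewrite /= !expr0 divr1 big_ord0 addr0.
have A0 : 0 < #|A|%:R :> R by rewrite ltr0n; apply/card_gt0P; exists x.
have A1 : 1 <= #|A|%:R :> R by move: A0; rewrite ltr0n ler1n.
have le_term (k : 'I_(size (x :: w))) t :
    t <= token_weight a (take k.+1 (x :: w)) *
         parse_weight a m (drop k.+1 (x :: w)) ->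
    t <= parse_weight a m.+1 (x :: w).
  move=> /le_trans; apply.
  rewrite [parse_weight a m.+1 _]/= add0r [leRHS](bigD1 k)//= lerDl sumr_ge0//.
  by move=> i _; rewrite mulr_ge0 ?token_weight_ge0 ?parse_weight_ge0.
have [/asboolP[v Hv /prefixP[s ws]]|nostart] := boolP (starts_in (x :: w)).
  have v0 : (0 < size v)%N by rewrite lt0n size_eq0 Hn0.
  have kv : ((size v).-1 < size (x :: w))%N.
    by rewrite prednK// ws size_cat leq_addr.
  have kvE : (Ordinal kv).+1 = size v by exact: prednK.
  apply: (le_term (Ordinal kv)); rewrite kvE ws take_size_cat//.
  rewrite drop_size_cat// size_cat exprD -mulrA.
  have sm : (size s <= m)%N.
    move: wm; rewrite ws size_cat -(prednK v0) addSn ltnS.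
    by apply: leq_trans; rewrite leq_addl.
  apply: ler_pM; rewrite ?mulr_ge0 ?exprn_ge0 ?invr_ge0//.
    rewrite /token_weight (mem_set Hv) ler_peMr ?exprn_ge0// lerDl.
    by rewrite divr_ge0.
  apply: le_trans (IH s sm); rewrite ler_wpM2l ?exprn_ge0//.
  rewrite lef_pV2 ?posrE ?exprn_gt0// ler_weXn2l//.
  by have := num_gaps_drop (size v) (v ++ s); rewrite drop_size_cat.
apply: (le_term ord0); rewrite /= drop0 take0 nostart add1n.
rewrite !exprS invfM mulrACA; apply: ler_pM.
- by rewrite divr_ge0.
- by rewrite divr_ge0 ?exprn_ge0.
- by rewrite /token_weight expr1 ler_wpM2l// mul1r lerDr.
- exact: IH.
Qed.

End Parsing.

Section WordSums.
Variables (R : realType) (A : finType).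

Lemma sum_tuple_cons n (f : seq A -> R) :
  \sum_(w : n.+1.-tuple A) f w = \sum_(x : A) \sum_(v : n.-tuple A) f (x :: v).
Proof.
rewrite pair_bigA/=.
rewrite (reindex (fun p : A * n.-tuple A => [tuple of p.1 :: p.2]))//=.
exists (fun w : n.+1.-tuple A => (thead w, [tuple of behead w])).
  by move=> [x v] _; rewrite theadE; congr pair; exact: val_inj.
by move=> w _; rewrite -tuple_eta.
Qed.

Lemma sum_tuple0 (f : seq A -> R) : \sum_(w : 0.-tuple A) f w = f [::].
Proof.
rewrite (big_pred1 [tuple]) // => w; rewrite [w]tuple0.
by apply/esym/eqP/val_inj.
Qed.

Lemma sum_tuple_cat k m (f : seq A -> R) :
  \sum_(w : (k + m).-tuple A) f w =
  \sum_(u : k.-tuple A) \sum_(v : m.-tuple A) f (u ++ v).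
Proof.
elim: k f => [|k IH] f.
  by rewrite (sum_tuple0 (fun u => \sum_(v : m.-tuple A) f (u ++ v))).
rewrite addSn sum_tuple_cons.
rewrite (sum_tuple_cons _ (fun u => \sum_(v : m.-tuple A) f (u ++ v))).
by apply: eq_bigr => x _; exact: (IH (fun w => f (x :: w))).
Qed.

End WordSums.

Section ParseSum.
Variables (R : realType) (A : alphabetType) (H : set (seq A)).

Lemma sum_token_weight (a : R) k :
  \sum_(v : k.-tuple A) token_weight H a v =
  a ^+ k * (num_words H k)%:R + (if k == 1%N then a else 0).
Proof.
have A0 : #|A|%:R != 0 :> R.
  by rewrite pnatr_eq0 -lt0n; apply/card_gt0P; exists point.
under eq_bigr do rewrite /token_weight size_tuple.
rewrite -big_distrr/= big_split/= mulrDr; congr (_ * _ + _).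
  by rewrite -natr_sum /num_words -sum1_card [in RHS]big_mkcond.
rewrite sumr_const card_tuple; case: eqP => [->|_].
  by rewrite expr1 expn1 mul1r -[_^-1 *+ _]mulr_natr mulVf// mulr1.
by rewrite mul0r mul0rn mulr0.
Qed.

(** Splitting off the first token factors the sum over words of length n into
    (weight of tokens of length k) times (weight of parses of length n - k); the
    second factor is at most 1 by induction and the first ones add up to at
    most 1. *)
Lemma sum_parse_weight_le1 (a : R) m n : 0 <= a ->
  (forall N, \sum_(k < N) a ^+ k.+1 * (num_words H k.+1)%:R + a <= 1) ->
  \sum_(w : n.-tuple A) parse_weight H a m w <= 1.
Proof.
move=> a0 Ha; elim: m n => [|m IH] [|n].
- by rewrite (sum_tuple0 (parse_weight H a 0)) /= addr0.
- by rewrite sum_tuple_cons big1// => x _; rewrite big1// => v _; rewrite /= addr0.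
- by rewrite (sum_tuple0 (parse_weight H a m.+1)) /= big_ord0 addr0.
have -> : \sum_(w : n.+1.-tuple A) parse_weight H a m.+1 w =
    \sum_(k < n.+1) \sum_(w : n.+1.-tuple A)
      token_weight H a (take k.+1 w) * parse_weight H a m (drop k.+1 w).
  rewrite exchange_big; apply: eq_bigr => w _ /=.
  have -> : (val w == [::]) = false.
    by apply/negP => /eqP /(congr1 size); rewrite size_tuple.
  by rewrite add0r size_tuple.
(* The letters contribute [a] through the term of length 1 only. *)
apply: le_trans (Ha n.+1).
apply: (@le_trans _ _ (\sum_(k < n.+1)
    (a ^+ k.+1 * (num_words H k.+1)%:R +
     (if k.+1 == 1%N then a else 0)))); last first.
  rewrite big_split/= lerD2l big_ord_recl/= big1 ?addr0//.
apply: ler_sum => -[k /= kn] _; rewrite -sum_token_weight.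
have [l nkl] : exists l, n.+1 = (k.+1 + l)%N.
  by exists (n.+1 - k.+1)%N; rewrite subnKC.
rewrite nkl (sum_tuple_cat _ _ (fun w => token_weight H a (take k.+1 w) *
  parse_weight H a m (drop k.+1 w))).
apply: ler_sum => u _.
under eq_bigr do rewrite take_size_cat ?size_tuple// drop_size_cat ?size_tuple//.
by rewrite -big_distrr/= ler_piMr ?token_weight_ge0 ?IH.
Qed.
End ParseSum.

(** * Entropy of a word distribution *)

Section Gibbs.
Variable R : realType.

Lemma gibbs_inequality (I : finType) (p q : I -> R) :
  (forall i, 0 <= p i) -> (forall i, 0 < q i) ->
  \sum_i q i <= \sum_i p i ->
  - \sum_i p i * ln (p i) <= - \sum_i p i * ln (q i).
Proof.
move=> p0 q0 qp; rewrite lerN2 -subr_le0 -sumrB.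
apply: (@le_trans _ _ (\sum_i (q i - p i))); last by rewrite sumrB subr_le0.
apply: ler_sum => i _.
have [->|/eqP pi0] := eqVneq (p i) 0; first by rewrite !mul0r subrr subr0 ltW.
have pi_gt0 : 0 < p i by rewrite lt_neqAle p0 andbT eq_sym; apply/eqP.
rewrite -mulrBr -ln_div ?posrE//.
have := @le_ln1Dx R (q i / p i - 1).
rewrite ltrBDr addNr divr_gt0// => /(_ isT); rewrite addrC subrK => lnle.
apply: le_trans (_ : p i * (q i / p i - 1) <= _); first by rewrite ler_wpM2l.
by rewrite mulrBr mulr1 mulrC divfK ?gt_eqF.
Qed.
End Gibbs.

Section EntropyBound.
Variables (R : realType) (A : alphabetType).
Implicit Types (H : set (seq A)) (alpha : R).

(** The extra term e^(-alpha) is the weight reserved for the single letters. *)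
Definition kraft_bound H alpha : Prop := forall N,
  \sum_(k < N) expR (- alpha) ^+ k.+1 * (num_words H k.+1)%:R + expR (- alpha)
    <= 1.

(** Gibbs' inequality against the lower bound of [parse_weight_ge]: every gap
    costs at most ln |A| on top of alpha per letter. *)
Lemma entropy_le_starts H alpha n (p : n.-tuple A -> R) :
  (forall v, H v -> v != [::]) -> kraft_bound H alpha ->
  (forall w, 0 <= p w) -> \sum_w p w = 1 ->
  - (\sum_w p w * ln (p w)) <= n%:R * alpha +
    ln #|A|%:R * \sum_(i < n) \sum_w p w * (~~ starts_in H (drop i w))%:R.
Proof.
move=> Hn0 Ha p0 p1; set a := expR (- alpha).
have A0 : 0 < #|A|%:R :> R by rewrite ltr0n; apply/card_gt0P; exists point.
pose low (w : n.-tuple A) : R := a ^+ n / #|A|%:R ^+ num_gaps H w.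
have low0 w : 0 < low w by rewrite divr_gt0 ?exprn_gt0 ?expR_gt0.
have lowS : \sum_w low w <= \sum_w p w.
  rewrite p1; apply: le_trans (@sum_parse_weight_le1 R A H a n n _ _) => //.
    apply: ler_sum => w _; rewrite /low -{1}(size_tuple w).
    by apply: parse_weight_ge; rewrite ?expR_ge0 ?size_tuple.
  exact: expR_ge0.
apply: le_trans (gibbs_inequality p0 low0 lowS) _.
rewrite -sumrN; under eq_bigr => w _.
  rewrite /low ln_div ?posrE ?exprn_gt0 ?expR_gt0// !lnXn ?expR_gt0// expRK.
  rewrite -mulrN opprB mulNrn opprK mulrDr -[ln _ *+ _]mulr_natr mulrCA.
  rewrite num_gapsE size_tuple natr_sum mulr_sumr.
  over.
rewrite big_split/= -big_distrr/= addrC -big_distrl/= p1 mul1r mulr_natl.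
by rewrite exchange_big.
Qed.

Definition ends_in H w : bool := `[< exists2 v, H v & suffix v w >].

Lemma num_words_rev H n : num_words [set v | H (rev v)] n = num_words H n.
Proof.
rewrite /num_words -!sum1_card.
rewrite [RHS](reindex_inj (h := fun w : n.-tuple A => [tuple of rev w])).
  by apply: eq_bigl => w; rewrite !inE.
by move=> u v /(congr1 val)/= /(can_inj revK) /val_inj.
Qed.

Lemma starts_in_rev H w : starts_in [set v | H (rev v)] (rev w) = ends_in H w.
Proof.
apply/asboolP/asboolP => -[v Hv vw].
  by exists (rev v) => //; rewrite /suffix revK.
by exists (rev v); rewrite /= ?revK.
Qed.

(** Reversal turns suffixes into prefixes and changes neither the entropy nor the
    number of words of [H] of each length. *)
Lemma entropy_le_ends H alpha n (p : n.-tuple A -> R) :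
  (forall v, H v -> v != [::]) -> kraft_bound H alpha ->
  (forall w, 0 <= p w) -> \sum_w p w = 1 ->
  - (\sum_w p w * ln (p w)) <= n%:R * alpha +
    ln #|A|%:R * \sum_(i < n) \sum_w p w * (~~ ends_in H (take (n - i) w))%:R.
Proof.
move=> Hn0 Ha p0 p1.
have rev_inj : injective (fun w : n.-tuple A => [tuple of rev w]).
  by move=> u v /(congr1 val)/= /(can_inj revK) /val_inj.
pose p' (w : n.-tuple A) := p [tuple of rev w].
have := @entropy_le_starts [set v | H (rev v)] alpha n p'.
have -> : \sum_w p' w * ln (p' w) = \sum_w p w * ln (p w).
  by rewrite [RHS](reindex_inj rev_inj).
have -> : \sum_w p' w = \sum_w p w by rewrite [RHS](reindex_inj rev_inj).
have -> : \sum_(i < n) \sum_w p' w *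
      (~~ starts_in [set v | H (rev v)] (drop i w))%:R =
    \sum_(i < n) \sum_w p w * (~~ ends_in H (take (n - i) w))%:R :> R.
  apply: eq_bigr => i _; rewrite [RHS](reindex_inj rev_inj)/=.
  apply: eq_bigr => w _; congr (_ * (~~ _)%:R).
  rewrite -starts_in_rev take_rev revK; congr (starts_in _ (drop _ _)).
  by rewrite size_tuple subKn// ltnW.
apply => //.
  by move=> v /Hn0; apply: contra => /eqP ->.
  by move=> N; under eq_bigr do rewrite num_words_rev; exact: Ha.
by move=> w; exact: p0.
Qed.

End EntropyBound.

(** * Counting heavy words *)

Section HeavyCount.
Variables (R : realType) (A : alphabetType) (F : set (seq A)).

(** A heavy word of length k is cut out of some word of F of length m <= 3k, at
    one of at most m positions. *)
Lemma num_heavy_le k M : (3 * k <= M)%N -> (0 < k)%N ->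
  (num_words (heavy F) k <= \sum_(1 <= m < M.+1 | (k <= m <= 3 * k)%N)
     m * num_words F m)%N.
Proof.
move=> kM k0.
pose ind m i (u : m.-tuple A) (v : k.-tuple A) : nat :=
  ((u : seq A) \in F) && (take k (drop i u) == v).
apply: (@leq_trans (\sum_(v : k.-tuple A)
     \sum_(1 <= m < M.+1 | (k <= m <= 3 * k)%N)
     \sum_(i < m) \sum_(u : m.-tuple A) ind m i u v)%N).
  rewrite /num_words -sum1_card big_mkcond/=; apply: leq_sum => v _.
  case: ifP => //; rewrite inE => -[u [Fu /infixP[s [t uE]]]].
  rewrite size_tuple => u3.
  have ku : (k <= size u)%N by rewrite uE !size_cat size_tuple; lia.
  have im : (size s < size u)%N.
    by rewrite uE !size_cat size_tuple -[ltnLHS]addn0 ltn_add2l addn_gt0 k0.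
  have uM : size u \in index_iota 1 M.+1.
    rewrite mem_index_iota (leq_trans k0 ku) ltnS.
    exact: leq_trans kM.
  rewrite big_mkcond (bigD1_seq (size u) uM)/= ?iota_uniq// ku u3/=.
  rewrite (bigD1 (Ordinal im))//= (bigD1 (in_tuple u))//=.
  rewrite /ind mem_set//= [in drop _ _]uE drop_size_cat//.
  rewrite take_size_cat ?size_tuple//.
  by rewrite eqxx.
rewrite exchange_big/=; apply: leq_sum => m _.
rewrite exchange_big/= -[X in (_ <= X * _)%N]card_ord -sum_nat_const.
apply: leq_sum => i _; rewrite exchange_big/= /num_words -sum1_card big_mkcond/=.
rewrite [leqRHS]big_mkcond/=.
apply: leq_sum => u _; rewrite /ind inE; case: (_ \in F); last by rewrite big1.
have -> : (\sum_(v : k.-tuple A) (true && (take k (drop i u) == v)) =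
    #|[pred v : k.-tuple A | take k (drop i u) == v]|)%N.
  by rewrite -sum1_card [RHS]big_mkcond; apply: eq_bigr => v _; rewrite inE.
by apply/card_le1_eqP => v v' /[!inE] /eqP + /eqP => -> /val_inj.
Qed.

(** A word of F of length m yields heavy words of at most m lengths k at no more
    than m positions, and e^(-k alpha) <= e^(-(m/3) alpha) since m <= 3k. *)
Lemma heavy_kraft_bound (alpha : R) : 0 < alpha ->
  F `<=` @nonempty_words A ->
  (\sum_(1 <= n <oo)
      ((n ^ 2)%:R * (num_words F n)%:R * expR (- (n%:R / 3 * alpha)))%:E
    <= (1 - expR (- alpha))%:E)%E ->
  kraft_bound (heavy F) alpha.
Proof.
move=> alpha0 F0 sumF N; rewrite -lerBrDr.
rewrite -lee_fin; apply: le_trans sumF.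
pose f n : R := (n ^ 2)%:R * (num_words F n)%:R * expR (- (n%:R / 3 * alpha)).
have f0 n : 0 <= f n by rewrite !mulr_ge0 ?expR_ge0.
apply: le_trans (nneseries_lim_ge (3 * N).+1 _); last first.
  by move=> n _ _; rewrite lee_fin f0.
rewrite sumEFin lee_fin.
apply: (@le_trans _ _ (\sum_(k < N) \sum_(1 <= m < (3 * N).+1 | (k.+1 <= m)%N)
    expR (- (m%:R / 3 * alpha)) * (m * num_words F m)%:R)).
  apply: ler_sum => k _; rewrite -expRM_natl.
  apply: (@le_trans _ _ (expR (k.+1%:R * - alpha) *
      \sum_(1 <= m < (3 * N).+1 | (k.+1 <= m <= 3 * k.+1)%N)
        (m * num_words F m)%:R)).
    rewrite -natr_sum ler_wpM2l ?expR_ge0// ler_nat num_heavy_le//.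
    by rewrite leq_mul2l ltn_ord orbT.
  rewrite mulr_sumr big_mkcondr/=; apply: ler_sum => m km.
  case: ifP => m3; last by rewrite mulr_ge0 ?expR_ge0.
  rewrite ler_wpM2r// ler_expR mulrN lerN2 ler_wpM2r ?(ltW alpha0)//.
  by rewrite ler_pdivrMr// mulrC -natrM ler_nat.
under eq_bigr do rewrite big_mkcond/=.
rewrite exchange_big/=; apply: ler_sum_nat => m _.
set c := expR _ * _; have c0 : 0 <= c by rewrite mulr_ge0 ?expR_ge0.
have -> : \sum_(k < N) (if (k < m)%N then c else 0) = c *+ minn N m.
  elim: N => [|N IH]; first by rewrite big_ord0 min0n.
  by rewrite big_ord_recr/= IH; case: ltnP => Nm;
    rewrite ?addr0 -?mulrSr; congr (_ *+ _); lia.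
apply: (@le_trans _ _ (c *+ m)).
  by rewrite -[leLHS]mulr_natl -[leRHS]mulr_natl ler_wpM2r// ler_nat geq_minr.
by rewrite /c -mulr_natl natrM expnS expn1 natrM; lra.
Qed.
End HeavyCount.

(** * Syndetic returns of an ergodic map *)

Section Recurrence.
Context {d : measure_display} {T : measurableType d} {R : realType}.
Variables (mu : probability T R) (S : T -> T).
Hypothesis measurable_S : measurable_fun setT S.
Hypothesis mu_invariant : forall B, measurable B -> mu (S @^-1` B) = mu B.

Lemma preimage_iterS k B : iter k.+1 S @^-1` B = S @^-1` (iter k S @^-1` B).
Proof. by apply/seteqP; split => x; rewrite /preimage/= -iterSr. Qed.

Lemma measurable_preimage_iter k B :
  measurable B -> measurable (iter k S @^-1` B).
Proof.
move=> mB; elim: k => [//|k IH].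
by rewrite preimage_iterS -[X in measurable X]setTI; exact: measurable_S.
Qed.

Lemma measure_preimage_iter k B :
  measurable B -> mu (iter k S @^-1` B) = mu B.
Proof.
move=> mB; elim: k => [//|k <-].
by rewrite preimage_iterS mu_invariant//; exact: measurable_preimage_iter.
Qed.

Hypothesis mu_ergodic : forall B, measurable B -> S @^-1` B = B ->
  mu B = 0%E \/ mu B = 1%E.

(** The union U of the preimages of Q is only subinvariant. The decreasing
    intersection of the preimages of U is invariant on the nose, and has the same
    measure as U because each of these preimages does. *)
Lemma ergodic_orbit_full Q : measurable Q -> (0 < mu Q)%E ->
  mu (\bigcup_n iter n S @^-1` Q) = 1%E.
Proof.
move=> mQ Q0; set U := \bigcup_n _.
have mU : measurable U.
  by apply: bigcupT_measurable => n; exact: measurable_preimage_iter.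
pose V m := iter m S @^-1` U.
have mV m : measurable (V m) by exact: measurable_preimage_iter.
have VS m : V m.+1 `<=` V m.
  move=> x [n _ /= nQ]; exists n.+1 => //=.
  by rewrite -iterS iterSr.
have mB : measurable (\bigcap_m V m) by exact: bigcapT_measurable.
have muB : mu (\bigcap_m V m) = mu U.
  have : (mu \o V) x @[x --> \oo] --> mu (\bigcap_m V m).
    apply: nonincreasing_cvg_mu => //.
      by rewrite (le_lt_trans (probability_le1 _ _)) ?ltry.
    by apply/nonincreasing_seqP => n; apply/subsetPset; exact: VS.
  have -> : mu \o V = fun=> mu U.
    by apply/funext => m /=; rewrite /V measure_preimage_iter.
  by move/cvg_lim => <- //; rewrite lim_cst.
rewrite -muB; have [|B0|//] := @mu_ergodic (\bigcap_m V m) mB.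
  apply/seteqP; split => x Bx m _.
    by apply: VS; rewrite /V preimage_iterS; exact: (Bx m I).
  by have := Bx m.+1 I; rewrite /V preimage_iterS.
have QU : (mu Q <= mu U)%E.
  apply: le_measure; rewrite ?inE//.
  by move=> x Qx; exists 0%N.
by move: Q0; rewrite ltNge -B0 muB QU.
Qed.

(** The bound holds in every window because W k N is the k-th preimage of W 0 N,
    so that one N serves all k. *)
Lemma ergodic_syndetic_return P Q : measurable P -> measurable Q ->
  (0 < mu P)%E -> (0 < mu Q)%E ->
  exists2 eps : R, 0 < eps &
    syndetic [set n | (eps%:E < mu (P `&` iter n S @^-1` Q))%E].
Proof.
move=> mP mQ P0 Q0.
pose W k N := \big[setU/set0]_(n < N) (iter (k + n) S @^-1` Q).
have mW k N : measurable (W k N).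
  by apply: bigsetU_measurable => n _; exact: measurable_preimage_iter.
have WE k N : W k N = \bigcup_(n < N) (iter (k + n) S @^-1` Q).
  by rewrite bigcup_mkord.
have [p pE] : exists p, mu P = p%:E.
  by exists (fine (mu P)); rewrite fineK// fin_num_measure.
have p0 : 0 < p by rewrite -lte_fin -pE.
have [N HN] : exists N, ((1 - p / 2)%:E < mu (W 0%N N))%E.
  have : (mu \o W 0%N) x @[x --> \oo] --> mu (\bigcup_n W 0%N n).
    apply: nondecreasing_cvg_mu => //; first exact: bigcupT_measurable.
    move=> m n mn; apply/subsetPset.
    exact: (@subset_bigsetU _ (fun n => iter (0 + n) S @^-1` Q)).
  have -> : mu (\bigcup_n W 0%N n) = 1%E.
    rewrite -(ergodic_orbit_full mQ Q0); congr (mu _).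
    apply/seteqP; split => x [n _].
      by rewrite WE => -[i _ Qi]; exists i.
    by move=> Qn; exists n.+1 => //; rewrite WE; exists n => /=.
  move=> cvgW; apply: contrapT => noN.
  have : (1 <= (1 - p / 2)%:E)%E.
    rewrite -(cvg_lim _ cvgW)//; apply: lime_le.
      by apply/cvg_ex; eexists; exact: cvgW.
    apply: nearW => n; rewrite leNgt; apply/negP => nW; apply: noN.
    by exists n.
  by rewrite lee_fin; lra.
(* Dividing by N + 1 spares the case N = 0. *)
exists (p / 2 / N.+1%:R); first by rewrite !divr_gt0.
exists N => k; apply: contrapT => noret.
have W_le : (mu (P `&` W k N) <= (p / 2)%:E)%E.
  rewrite /W big_distrr/=.
  apply: le_trans (@Boole_inequality _ _ _ mu
    (fun n => P `&` iter (k + n) S @^-1` Q) N _) _.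
    by move=> n _; apply: measurableI => //; exact: measurable_preimage_iter.
  apply: (@le_trans _ _ (\sum_(n < N) (p / 2 / N.+1%:R)%:E)%E).
    apply: lee_sum => n _; rewrite leNgt; apply/negP => ret; apply: noret.
    exists (k + n)%N => //.
    by have := ltn_ord n; lia.
  rewrite sumEFin lee_fin sumr_const card_ord -[leLHS]mulr_natr.
  rewrite -[leLHS]mulrA ler_piMr ?divr_ge0 ?(ltW p0)//.
  by rewrite mulrC ler_pdivrMr// mul1r ler_nat.
have : (mu P <= mu (P `&` W k N) + mu (~` W k N))%E.
  apply: (@le_trans _ _ (mu ((P `&` W k N) `|` ~` W k N))).
    apply: le_measure; rewrite ?inE//.
      by apply: measurableU; [exact: measurableI|exact: measurableC].
    by move=> x Px; have [Wx|Wx] := pselect (W k N x); [left|right].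
  apply: measureU2; [exact: measurableI|exact: measurableC].
have -> : mu (~` W k N) = (1 - mu (W 0%N N))%E.
  rewrite probability_setC//; congr (_ - _)%E.
  rewrite -(measure_preimage_iter k (mW 0%N N)); congr (mu _).
  rewrite !WE preimage_bigcup; apply: eq_bigcupr => n _.
  by apply/seteqP; split => x; rewrite /preimage/= add0n addnC iterD.
rewrite pE; apply/negP; rewrite -ltNge.
apply: le_lt_trans (leeD2r _ W_le) _.
have [w wE] : exists w, mu (W 0%N N) = w%:E.
  by exists (fine (mu (W 0%N N))); rewrite fineK// fin_num_measure.
by move: HN; rewrite wE -EFinB -EFinD !lte_fin; lra.
Qed.
End Recurrence.

(** * Blocks and measurability in the full shift *)

Section SubshiftMeasurability.
Variable A : alphabetType.
Implicit Types x : borel_full_shift A.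

Lemma coordinate_continuous (i : int) :
  continuous (fun x : full_shift A => x i : discrete_topology A).
Proof. exact: (@proj_continuous int (fun=> discrete_topology A) i). Qed.

Lemma shift_map_continuous :
  continuous (@shift_map A : full_shift A -> full_shift A).
Proof.
move=> x.
have filter_x : Filter (fmap (@shift_map A) (nbhs (x : full_shift A))).
  exact: (@fmap_filter _ _ _ _ (@nbhs_filter (full_shift A) x)).
apply: ((@cvg_sup (int -> discrete_topology A) int
  (fun i => Topological.class
    (initial_topology (fun f : int -> discrete_topology A => f i)))
  _ (shift_map x) filter_x).2) => i B [_ [[C oC <-] Cx] CB].
have : nbhs (x : full_shift A) (fun y : full_shift A => C (y (i + 1))).
  apply: (@coordinate_continuous (i + 1) x C).
  exact: (@open_nbhs_nbhs (discrete_topology A)).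
apply: (@filterS _ _ (@nbhs_filter (full_shift A) x)) => y Cy.
exact: CB.
Qed.

Lemma measurable_shift_map : measurable_fun setT (@shift_map A).
Proof.
have gen : measurable =
    <<s @open (full_shift A) >> :> set (set (borel_full_shift A)).
  by [].
apply: (measurability _ gen).
move=> _ [B oB <-]; rewrite setTI; apply: sub_gen_smallest.
exact: ((@continuousP (full_shift A) (full_shift A) _).1
  shift_map_continuous B oB).
Qed.

Lemma measurable_coordinate (i : int) (a : A) :
  measurable [set x : borel_full_shift A | x i = a].
Proof.
apply: sub_gen_smallest.
exact: ((@continuousP (full_shift A) (discrete_topology A) _).1
  (@coordinate_continuous i) [set a] (discrete_open _)).
Qed.

Lemma block_cons x i n : block x i n.+1 = x i :: block x (i + 1) n.
Proof.
rewrite /block /mkseq /= addr0; congr cons.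
rewrite -[1%N]/(1 + 0)%N iotaDl -map_comp; apply: eq_map => k /=.
by rewrite PoszD addrA.
Qed.

Lemma measurable_block (D : set (seq A)) i n :
  measurable [set x : borel_full_shift A | D (block x i n)].
Proof.
elim: n D i => [|n IH] D i.
  have [D0|D0] := pselect (D [::]).
    by rewrite (_ : mkset _ = setT) //; apply/seteqP; split.
  by rewrite (_ : mkset _ = set0) //; apply/seteqP; split.
rewrite (_ : mkset _ = \bigcup_(a in [set: A])
    ([set x : borel_full_shift A | x i = a] `&`
     [set x | [set w | D (a :: w)] (block x (i + 1) n)])).
  apply: fin_bigcup_measurable => [|a _]; first exact: finite_finset.
  by apply: measurableI; [exact: measurable_coordinate|exact: IH].
apply/seteqP; split => x /=; rewrite block_cons.
  by exists (x i).
by move=> [a _ [/= ->]].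
Qed.

Lemma measurable_subshift (F : set (seq A)) : measurable (subshift F).
Proof.
rewrite -[subshift F]setCK; apply: measurableC.
rewrite (_ : ~` _ = \bigcup_(ui in [set: seq A * int])
  [set x | [set v | F ui.1 /\ v = ui.1] (block x ui.2 (size ui.1))]).
  apply: countable_bigcupT_measurable; first exact: countableP.
  by move=> ui; exact: measurable_block.
apply/seteqP; split => x /=.
  move=> /existsNP[u /existsNP[i /not_implyP[Fu /contrapT xu]]].
  by exists (u, i).
by move=> [[u i] _ /= [Fu xu]] /(_ u i Fu).
Qed.

Lemma size_block x i n : size (block x i n) = n.
Proof. by rewrite size_mkseq. Qed.

Lemma take_block x i k n : (k <= n)%N -> take k (block x i n) = block x i k.
Proof.
by move=> kn; rewrite /block /mkseq -map_take take_iota (minn_idPl kn).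
Qed.

Lemma drop_block x i k n : drop k (block x i n) = block x (i + k%:Z) (n - k).
Proof.
elim: k i n => [|k IH] i n; first by rewrite drop0 addr0 subn0.
case: n => [|n]; first by rewrite sub0n.
by rewrite block_cons/= IH subSS -addrA -PoszD add1n.
Qed.

Lemma block_iter_shift x i k n :
  block (iter k (@shift_map A) x) i n = block x (i + k%:Z) n.
Proof.
elim: k x => [|k IH] x; first by rewrite addr0.
rewrite iterSr IH; apply: eq_map => j /=.
by rewrite /shift_map; congr (x _); lia.
Qed.

Lemma subshift_iter_shift (F : set (seq A)) k x :
  subshift F x -> subshift F (iter k (@shift_map A) x).
Proof. by move=> Xx u i Fu; rewrite block_iter_shift; exact: Xx. Qed.

End SubshiftMeasurability.

(** * Positive measure from an entropy gap *)

Section PositiveMeasure.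
Variables (R : realType) (A : alphabetType) (F : set (seq A)).
Variable mu : probability (borel_full_shift A) R.
Local Notation X := (subshift F).

Lemma measurable_cylinder w : measurable (cylinder X w).
Proof.
apply: measurableI; first exact: measurable_subshift.
exact: (@measurable_block A [set v | v = w] 1 (size w)).
Qed.

Lemma sum_measure_cylinder n (D : pred (seq A)) :
  \sum_(w : n.-tuple A) fine (mu (cylinder X w)) * (D w)%:R =
  fine (mu (X `&` [set x | D (block x 1 n)])).
Proof.
pose C (w : n.-tuple A) := cylinder X w.
have mC w : measurable (C w) by exact: measurable_cylinder.
have -> : X `&` [set x | D (block x 1 n)] =
    \bigcup_(w in [set w : n.-tuple A | D w]) C w.
  apply/seteqP; split => x.
    move=> [Xx Dx]; have sx : size (block x 1 n) == n by rewrite size_block.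
    by exists (Tuple sx) => //; split; rewrite //= size_block.
  by move=> [w Dw [Xx xw]]; split => //=; rewrite -(size_tuple w) xw.
rewrite measure_fin_bigcup//; first last.
- move=> u v _ _ [x [[_ xu] [_ xv]]]; apply: val_inj.
  by move: xu xv; rewrite /= !size_tuple => <- <-.
- exact: finite_finset.
rewrite (@fsbigE _ _ _ _ _ [seq w : n.-tuple A <- enum {: n.-tuple A} | D w]).
- rewrite big_filter_cond big_enum_cond/= -[RHS]sum_fine; last first.
    by move=> w _; apply: fin_num_measure; exact: mC.
  rewrite [RHS]big_mkcond/=; apply: eq_bigr => w _.
  have [Dw|] := boolP (D w); last by rewrite mulr0.
  by rewrite mem_set// mulr1.
- by rewrite filter_uniq ?enum_uniq.
- by move=> w /=; rewrite mem_filter => /andP[].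
- by move=> w Dw; rewrite mem_filter mem_enum andbT Dw.
Qed.

(** If the intersection were null, the averages of mu (E i) would tend to 0, and
    dividing by n would give entropy at most alpha. *)
Lemma measure_bigcap_gt0 (E : nat -> set (borel_full_shift A)) (alpha L : R) :
  (forall j, measurable (E j)) -> (forall j, E j.+1 `<=` E j) ->
  0 < alpha -> 0 <= L -> alpha < measure_entropy X mu ->
  (forall n, - \sum_(w : n.-tuple A)
      fine (mu (cylinder X w)) * ln (fine (mu (cylinder X w))) <=
    n%:R * alpha + L * \sum_(i < n) fine (mu (E i.+1))) ->
  (0 < mu (\bigcap_j E j))%E.
Proof.
move=> mE Edec alpha0 L0 gap entropy_le.
have mB : measurable (\bigcap_j E j) by exact: bigcapT_measurable.
rewrite lt0e measure_ge0 andbT; apply/eqP => B0.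
pose d j : R := fine (mu (E j.+1)).
have d_cvg : d @ \oo --> (0 : R).
  rewrite /d (cvg_shiftS (fun j => fine (mu (E j)))).
  have muE_cvg : (mu \o E) @ \oo --> mu (\bigcap_j E j).
    apply: nonincreasing_cvg_mu => //.
      by rewrite (le_lt_trans (probability_le1 _ _)) ?ltry.
    by apply/nonincreasing_seqP => n; apply/subsetPset; exact: Edec.
  by rewrite B0 in muE_cvg; exact: (@fine_cvg _ _ _ _ (mu \o E) 0 muE_cvg).
move: gap; rewrite /measure_entropy; set f := (fun n : nat => _).
apply/negP; rewrite -leNgt.
(* A divergent sequence has limit 0 by convention, which is below alpha. *)
have [cf|ncf] := pselect (cvgn f); last first.
  by rewrite (dvgP ncf) ltW.
have mean_cvg : (fun n => alpha + L * arithmetic_mean d n) @ \oo --> alpha.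
  rewrite -[X in _ --> X]addr0; apply: cvgD; first exact: cvg_cst.
  by rewrite -[X in _ --> X](mulr0 L); apply: cvgMl_tmp; exact: cesaro.
have fS_cvg : (fun n => f n.+1) @ \oo --> limn f.
  by rewrite (cvg_shiftS f).
apply: (ler_cvg_to fS_cvg mean_cvg); apply: nearW => n.
rewrite /f mulNr -mulrN.
apply: le_trans (ler_wpM2l _ (entropy_le n.+1)) _; first by rewrite invr_ge0.
by rewrite mulrDr mulKf// mulrCA /arithmetic_mean /series/= big_mkord.
Qed.

Lemma fine_measure_le (B C : set (borel_full_shift A)) :
  measurable B -> measurable C -> B `<=` C -> fine (mu B) <= fine (mu C).
Proof.
move=> mB mC BC; apply: fine_le; rewrite ?fin_num_measure//.
by apply: le_measure; rewrite ?inE.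
Qed.

Variable H : set (seq A).
Hypothesis mu_X : mu X = 1%E.
Hypothesis mu_invariant : shift_invariant mu.
Hypothesis H_nonempty : forall v, H v -> v != [::].
Variable alpha : R.
Hypothesis alpha0 : 0 < alpha.
Hypothesis H_kraft : kraft_bound H alpha.
Hypothesis entropy_gap : alpha < measure_entropy X mu.

Let sum_cylinder n : \sum_(w : n.-tuple A) fine (mu (cylinder X w)) = 1.
Proof.
under eq_bigr do rewrite -[fine _]mulr1.
rewrite (sum_measure_cylinder n xpredT).
by rewrite (_ : [set _ | _] = setT) ?setIT ?mu_X//; apply/seteqP; split.
Qed.

Let measurable_block_event (b : pred (seq A)) i j :
  measurable (X `&` [set x | b (block x i j)]).
Proof.
apply: measurableI; first exact: measurable_subshift.
exact: (measurable_block [set w | b w]).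
Qed.

Let ln_card_ge0 : 0 <= ln #|A|%:R :> R.
Proof. by rewrite ln_ge0// ler1n; apply/card_gt0P; exists point. Qed.

Let cylinder_ge0 n (w : n.-tuple A) : 0 <= fine (mu (cylinder X w)).
Proof. exact: fine_ge0. Qed.

(** Invariance moves an event read off coordinates 1, ..., n to any other place;
    only an inequality is claimed, so that forward invariance of X suffices. *)
Let measure_event_le (b c : pred (seq A)) n k i j :
  (forall x, b (block x 1 n) -> c (block x (i + k%:Z) j)) ->
  fine (mu (X `&` [set x | b (block x 1 n)])) <=
  fine (mu (X `&` [set x | c (block x i j)])).
Proof.
move=> bc; have mc := measurable_block_event c i j.
rewrite -(measure_preimage_iter (@measurable_shift_map A) mu_invariant k mc).
apply: fine_measure_le => //.
  by apply: measurable_preimage_iter => //; exact: measurable_shift_map.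
move=> x [Xx bx]; split; first exact: subshift_iter_shift.
by rewrite /= block_iter_shift; exact: bc.
Qed.

(** For a position with m letters from it up to n, to be a gap of x_1 ... x_n is
    by invariance an event of the measure of the m-th set below, which only
    forbids words of [H] that fit into these m letters. *)
Lemma measure_no_start_gt0 :
  (0 < mu (\bigcap_j (X `&` [set x | ~~ starts_in H (block x 1 j)])))%E.
Proof.
apply: (measure_bigcap_gt0 (alpha := alpha) (L := ln #|A|%:R)) => //.
- by move=> j; exact: (measurable_block_event (fun w => ~~ starts_in H w)).
- move=> j x [Xx nx]; split => //; move: nx; apply: contra => /asboolP[v Hv vx].
  apply/asboolP; exists v => //; apply: prefix_trans vx _.
  by rewrite -(take_block x 1 (leqnSn j)) prefix_take.
move=> n; apply: le_trans (entropy_le_starts H_nonempty H_kraft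
  (@cylinder_ge0 n) (sum_cylinder n)) _.
rewrite lerD2l ler_wpM2l//.
rewrite [leRHS](reindex_inj rev_ord_inj)/=; apply: ler_sum => i _.
rewrite subnSK// (sum_measure_cylinder n (fun w => ~~ starts_in H (drop i w))).
apply: (@measure_event_le (fun w => ~~ starts_in H (drop i w))
  (fun w => ~~ starts_in H w) n i) => x.
by rewrite drop_block.
Qed.

Lemma measure_no_end_gt0 :
  (0 < mu (\bigcap_j (X `&` [set x | ~~ ends_in H (block x (1 - j%:Z) j)])))%E.
Proof.
apply: (measure_bigcap_gt0 (alpha := alpha) (L := ln #|A|%:R)) => //.
- by move=> j; exact: (measurable_block_event (fun w => ~~ ends_in H w)).
- move=> j x [Xx nx]; split => //; move: nx; apply: contra => /asboolP[v Hv vx].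
  apply/asboolP; exists v => //; apply: suffix_trans vx _.
  have -> : block x (1 - j%:Z) j = drop 1 (block x (1 - j.+1%:Z) j.+1).
    by rewrite drop_block subSS subn0; congr block; lia.
  exact: suffix_drop.
move=> n; apply: le_trans (entropy_le_ends H_nonempty H_kraft
  (@cylinder_ge0 n) (sum_cylinder n)) _.
rewrite lerD2l ler_wpM2l//.
rewrite [leRHS](reindex_inj rev_ord_inj)/=; apply: ler_sum => i _.
rewrite subnSK//.
rewrite (sum_measure_cylinder n (fun w => ~~ ends_in H (take (n - i) w))).
apply: (@measure_event_le (fun w => ~~ ends_in H (take (n - i) w))
  (fun w => ~~ ends_in H w) n (n - i)) => x.
by rewrite subrK take_block// leq_subr.
Qed.

End PositiveMeasure.

Theorem theorem6p5 (R : realType) (A : alphabetType) (F : set (seq A)) :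
  F `<=` @nonempty_words A ->
  subshift F !=set0 ->
  (exists2 alpha : R, alpha < topological_entropy R (subshift F) &
    (\sum_(1 <= n <oo)
        ((n ^ 2)%:R * (num_words F n)%:R * expR (- (n%:R / 3 * alpha)))%:E
      < (1 - expR (- alpha))%:E)%E) ->
  forall mu : probability (borel_full_shift A) R,
    ergodic mu ->
    measure_of_maximal_entropy (subshift F) mu ->
    exists (eps : R) (S : set nat),
      [/\ 0 < eps, syndetic S &
          forall n, S n ->
            (eps%:E < mu (cylinder_union (subshift F) (good_words F) n))%E].
Proof.
move=> F0 _ [alpha alpha_lt sumF] mu [mu_inv mu_erg] [_ muX mu_max].
have alpha0 : 0 < alpha.
  have : 0 < 1 - expR (- alpha).
    rewrite -lte_fin; apply: le_lt_trans sumF.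
    by apply: nneseries_ge0 => n _ _; rewrite lee_fin !mulr_ge0 ?expR_ge0.
  by rewrite subr_gt0 expR_lt1 oppr_lt0.
have heavy0 v : heavy F v -> v != [::].
  move=> [u [Fu _ uv]]; apply: contraPneq uv => ->.
  by rewrite muln0 leqn0 size_eq0; apply/negP; exact: F0.
have kraft := heavy_kraft_bound alpha0 F0 (ltW sumF).
have gap : alpha < measure_entropy (subshift F) mu by rewrite mu_max.
have P0 := measure_no_start_gt0 muX mu_inv heavy0 alpha0 kraft gap.
have Q0 := measure_no_end_gt0 muX mu_inv heavy0 alpha0 kraft gap.
have mX := measurable_subshift F.
set P := \bigcap_j _ in P0; set Q := \bigcap_j _ in Q0.
have mP : measurable P.
  apply: bigcapT_measurable => j; apply: measurableI => //.
  exact: (measurable_block [set w | ~~ starts_in (heavy F) w]).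
have mQ : measurable Q.
  apply: bigcapT_measurable => j; apply: measurableI => //.
  exact: (measurable_block [set w | ~~ ends_in (heavy F) w]).
have [eps eps0 [N retN]] := ergodic_syndetic_return
  (@measurable_shift_map A) mu_inv mu_erg mP mQ P0 Q0.
exists eps, [set n | (0 < n)%N /\
  (eps%:E < mu (P `&` iter n (@shift_map A) @^-1` Q))%E].
split=> //.
  (* Starting the window at k + 1 avoids n = 0, for which there is no word. *)
  exists N.+1 => k; have [n nret /andP[kn nk]] := retN k.+1.
  exists n; first by split => //; exact: leq_trans kn.
  by rewrite (ltnW kn) addnS -addSn.
move=> n [n0 /lt_le_trans]; apply; apply: le_measure; rewrite ?inE.
- apply: measurableI => //; apply: measurable_preimage_iter => //.
  exact: measurable_shift_map.
- rewrite (_ : cylinder_union _ _ _ = subshift F `&`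
    [set x | good_words F (block x 1 n)]).
    by apply: measurableI => //; exact: measurable_block.
  apply/seteqP; split => x.
    by move=> [w [Gw wn] [Xx xw]]; split => //; rewrite /= -wn xw.
  move=> [Xx Gx]; exists (block x 1 n).
    by split => //; exact: size_block.
  by split => //; rewrite size_block.
move=> x [Px Qx]; have [Xx nostart] := Px n I.
have [_ noend] := Qx n I.
exists (block x 1 n); last by split => //; rewrite size_block.
split; last exact: size_block.
split.
- split; first by rewrite /nonempty_words/= -size_eq0 size_block -lt0n.
  by exists x, 1; rewrite size_block.
- by move=> startx; move/asboolP: nostart.
- move: noend; rewrite /= block_iter_shift subrK => /asboolP noend endx.
  exact: noend.
Qed.
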